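(* Let $\mathscr{A}$ be an ordinary musical Riemannian Rinehart space with Levi-Civita connection $\nabla^{\mathscr{A}}$, let $I$ be an ideal of its function space $\mathcal{O}_{\mathscr{A}}$, and suppose that there is given a projection $(\cdot)^{\top}:\mathfrak{X}_{\mathscr{A}}\to\mathfrak{X}_{\mathscr{A}}^{\top}$ modulo $I$. Then a Levi-Civita connection $\nabla^{\top}$ is induced on the quotient $\mathscr{C}^{\top}$ (with function space $\mathcal{O}_{\mathscr{C}}=\mathcal{O}_{\mathscr{A}}/I$ and tangent space $\mathfrak{X}_{\mathscr{C}}^{\top}$), which is uniquely determined by the equation $$\nabla^{\top}_{X}Y=(\nabla^{\mathscr{C}}_{X}Y)^{\top},\qquad X,Y\in\mathfrak{X}_{\mathscr{C}}^{\top}.$$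
   Context: All rings and algebras (except Lie algebras) are associative and commutative, over a fixed ground ring $\mathbb{K}$. A bilinear map is non-degenerate if no nonzero element in either argument annihilates the whole other module. A Rinehart space $\mathscr{A}$ consists of a $\mathbb{K}$-algebra $\mathcal{O}=\mathcal{O}_{\mathscr{A}}$, $\mathcal{O}$-modules $\mathfrak{X}=\mathfrak{X}_{\mathscr{A}}$ (tangent space) and $\Omega=\Omega_{\mathscr{A}}$ (cotangent space), an $\mathcal{O}$-bilinear pairing $\langle\cdot,\cdot\rangle:\mathfrak{X}\otimes\Omega\to\mathcal{O}$, a $\mathbb{K}$-Lie algebra structure on $\mathfrak{X}$ and a $\mathbb{K}$-linear derivation $\mathrm{d}:\mathcal{O}\to\Omega$ such that, with $\mathrm{d}_Xf:=\langle X,\mathrm{d}f\rangle$, $[X,fY]=(\mathrm{d}_Xf)Y+f[X,Y]$; moreover $\mathfrak{X},\Omega$ are finite-dimensional over $\mathcal{O}$ (dimension = largest cardinality of a linearly independent subset), $\Omega$ is spanned over $\mathcal{O}$ by $\mathrm{d}\mathcal{O}$, and the pairing is non-degenerate. A Riemannian metric is a symmetric $\mathcal{O}$-bilinear form $\langle\cdot,\cdot\rangle$ on $\mathfrak{X}$. It is musical if it is non-degenerate and duplicative, the latter meaning: for each $Y\in\mathfrak{X}$ there is $\omega\in\Omega$, and for each $\omega\in\Omega$ there is $Y\in\mathfrak{X}$, with $\langle X,\omega\rangle=\langle X,Y\rangle$ for all $X\in\mathfrak{X}$. $\mathscr{A}$ is ordinary if for every ideal $J\subset\mathcal{O}$ the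 submodule $\{X\in\mathfrak{X}:\langle X,\Omega\rangle\subset J\}$ is spanned by $J\mathfrak{X}$ and $\{\omega\in\Omega:\langle\mathfrak{X},\omega\rangle\subset J\}$ is spanned by $J\Omega$. A Levi-Civita connection assigns $\mathcal{O}$-linearly to $X\in\mathfrak{X}$ a $\mathbb{K}$-linear map $\nabla_X:\mathfrak{X}\to\mathfrak{X}$ with $\nabla_X(fY)=(\mathrm{d}_Xf)Y+f\nabla_XY$, $[X,Y]=\nabla_XY-\nabla_YX$ and $\mathrm{d}_X\langle Y,Z\rangle=\langle\nabla_XY,Z\rangle+\langle Y,\nabla_XZ\rangle$. For an ideal $I\subset\mathcal{O}_{\mathscr{A}}$: let $\Omega_{\mathscr{A}}^{\bot}$ be the $\mathcal{O}_{\mathscr{A}}$-span of $\mathrm{d}I$; $\mathfrak{X}_{\mathscr{A}}^{\top}=\{X\in\mathfrak{X}_{\mathscr{A}}:\langle X,\Omega_{\mathscr{A}}^{\bot}\rangle\subset I\}$ (equivalently $\mathrm{d}_XI\subset I$); $\mathfrak{X}_{\mathscr{A}}^{0}=\{X\in\mathfrak{X}_{\mathscr{A}}:\langle X,\Omega_{\mathscr{A}}\rangle\subset I\}$. Put $\mathcal{O}_{\mathscr{C}}=\mathcal{O}_{\mathscr{A}}/I$, $\mathfrak{X}_{\mathscr{C}}=\mathfrak{X}_{\mathscr{A}}/\mathfrak{X}_{\mathscr{A}}^{0}$, $\mathfrak{X}_{\mathscr{C}}^{\top}=\mathfrak{X}_{\mathscr{A}}^{\top}/\mathfrak{X}_{\mathscr{A}}^{0}\subset\mathfrak{X}_{\mathscr{C}}$,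 $\Omega_{\mathscr{C}}^{\top}=\Omega_{\mathscr{A}}/\Omega_{\mathscr{A}}^{\bot}$, with quotient maps $\rho^*:\mathcal{O}_{\mathscr{A}}\to\mathcal{O}_{\mathscr{C}}$, $\rho^\sharp:\mathfrak{X}_{\mathscr{A}}\to\mathfrak{X}_{\mathscr{C}}$. The pairing, inner product, Lie bracket (on $\mathfrak{X}_{\mathscr{A}}^\top$) and differential of $\mathscr{A}$ descend to these quotients; $\mathscr{C}^{\top}=(\mathfrak{X}_{\mathscr{C}}^{\top},\Omega_{\mathscr{C}}^{\top})$ with this induced structure is the quotient Rinehart space, and $\mathfrak{X}_{\mathscr{C}}$ carries the induced inner product. The connection $\nabla^{\mathscr{C}}$, with $\nabla^{\mathscr{C}}_X:\mathfrak{X}_{\mathscr{C}}\to\mathfrak{X}_{\mathscr{C}}$ for $X\in\mathfrak{X}_{\mathscr{C}}^{\top}$, is the (well-defined) one given by $\nabla^{\mathscr{C}}_{\rho^\sharp X}(\rho^\sharp Y)=\rho^\sharp(\nabla^{\mathscr{A}}_XY)$ for $X\in\mathfrak{X}_{\mathscr{A}}^{\top}$, $Y\in\mathfrak{X}_{\mathscr{A}}$. A projection $(\cdot)^\top:\mathfrak{X}_{\mathscr{A}}\to\mathfrak{X}_{\mathscr{A}}^{\top}$ modulo $I$ is an $\mathcal{O}_{\mathscr{A}}$-linear map with $\langle X,Y^\top\rangle-\langle X,Y\rangle\in I$ for all $X\in\mathfrak{X}_{\mathscr{A}}^{\top}$, $Y\in\mathfrak{X}_{\mathscr{A}}$; it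 induces $(\cdot)^\top:\mathfrak{X}_{\mathscr{C}}\to\mathfrak{X}_{\mathscr{C}}^{\top}$ by $(\rho^\sharp X)^\top=\rho^\sharp(X^\top)$. *)

(* Defs.v *)
From HB Require Import structures.
From mathcomp Require Import all_boot all_algebra.
From mathcomp Require Import generic_quotient ring_quotient boolp.

Set Implicit Arguments.
Unset Strict Implicit.
Unset Printing Implicit Defensive.

Import GRing.Theory.
Local Open Scope ring_scope.
Local Open Scope quotient_scope.

(* Rings may be trivial ([comPzRingType]) because the quotient by the unit
   ideal is allowed.  For the same reason a K-algebra is given by a ring
   morphism out of K: [algType] would exclude the trivial ring.               *)

(* [ideal R] is not [idealr R], which only contains the proper ideals. *)
Notation ideal R := (submodClosed (R^o)).

Section Modules.
Variables (R : comPzRingType) (M : lmodType R).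

Definition span (S : M -> Prop) (x : M) : Prop :=
  exists n (a : 'I_n -> R) (s : 'I_n -> M),
    (forall i, S (s i)) /\ x = \sum_i a i *: s i.

Definition lin_indep n (s : 'I_n -> M) : Prop :=
  forall a : 'I_n -> R, \sum_i a i *: s i = 0 -> forall i, a i = 0.

(* The injectivity of [s] is only needed over the trivial ring. *)
Definition finite_dim : Prop :=
  exists N, forall n (s : 'I_n -> M), injective s -> lin_indep s -> (n <= N)%N.

Lemma span_gen (S : M -> Prop) x : S x -> span S x.
Proof.
by move=> Sx; exists 1, (fun=> 1), (fun=> x); rewrite big_ord1 scale1r.
Qed.

Lemma span0 S : span S 0.
Proof.
by exists 0, (fun=> 0), (fun=> 0); rewrite big_ord0; split=> // -[].
Qed.

Lemma spanZD S a x y : span S x -> span S y -> span S (a *: x + y).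
Proof.
move=> [m [b [s [Ss ->]]]] [n [c [t [St ->]]]].
exists (m + n), (fun i => match split i with inl j => a * b j | inr k => c k end),
  (fun i => match split i with inl j => s j | inr k => t k end).
split; first by move=> i; case: (split i).
rewrite big_split_ord /= scaler_sumr; congr (_ + _); apply: eq_bigr => i _.
  by rewrite (unsplitK (inl i : 'I_m + 'I_n)) scalerA.
by rewrite (unsplitK (inr i : 'I_m + 'I_n)).
Qed.

Lemma span_ind (S P : M -> Prop) :
  P 0 -> (forall x y, P x -> P y -> P (x + y)) ->
  (forall a x, S x -> P (a *: x)) -> forall x, span S x -> P x.
Proof.
move=> P0 PD PZ x [n [a [s [Ss ->]]]].
by apply: (big_ind P) => // i _; apply: PZ.
Qed.

End Modules.

Section Quotients.
Variables (R : comPzRingType).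

Section Zmod.
Variables (M : lmodType R) (N : submodClosed M).

Definition submod_pred : {pred M} := N.

Fact submod_pred_closed : zmod_closed submod_pred.
Proof.
split; first exact: (rpred0 N).
by move=> x y Nx Ny; rewrite -scaleN1r; exact: (rpredD (S := N) Nx (rpredZ (s := N) (-1) Ny)).
Qed.
HB.instance Definition _ :=
  GRing.isZmodClosed.Build M submod_pred submod_pred_closed.
End Zmod.

Section Ring.
Variable I : ideal R.

Definition quot_ring : Type := Quotient.quot (submod_pred I).
HB.instance Definition _ := GRing.Zmodule.on quot_ring.

Definition pi_ring (a : R) : quot_ring := \pi_(Quotient.quot (submod_pred I)) a.

Lemma pi_ringP (x : quot_ring) : pi_ring (repr x) = x.
Proof. exact: reprK. Qed.

Lemma eq_pi_ring a b : pi_ring a = pi_ring b <-> a - b \in I.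
Proof.
split=> [/eqP|ab]; first by rewrite -Quotient.idealrBE.
by apply/eqP; rewrite -Quotient.idealrBE.
Qed.

Lemma pi_ringD a b : pi_ring (a + b) = pi_ring a + pi_ring b.
Proof. by rewrite /pi_ring raddfD. Qed.

Definition quot_one : quot_ring := pi_ring 1.
Definition quot_mul (x y : quot_ring) : quot_ring := pi_ring (repr x * repr y).

Lemma idealM a b : b \in I -> a * b \in I.
Proof. by move=> Ib; apply: (rpredZ (s := I) a Ib). Qed.

Lemma pi_ring_mul a b : quot_mul (pi_ring a) (pi_ring b) = pi_ring (a * b).
Proof.
apply/eq_pi_ring; set a' := repr _; set b' := repr _.
have Ia : a' - a \in I by apply/eq_pi_ring; rewrite pi_ringP.
have Ib : b' - b \in I by apply/eq_pi_ring; rewrite pi_ringP.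
have -> : a' * b' - a * b = a' * (b' - b) + b * (a' - a).
  by rewrite !mulrBr [b * a']mulrC [b * a]mulrC addrA subrK.
by apply: (rpredD (idealM _ Ib) (idealM _ Ia)).
Qed.

Fact quot_mulA : associative quot_mul.
Proof.
move=> x y z; rewrite -[x]pi_ringP -[y]pi_ringP -[z]pi_ringP.
by rewrite !pi_ring_mul mulrA.
Qed.
Fact quot_mulC : commutative quot_mul.
Proof.
by move=> x y; rewrite -[x]pi_ringP -[y]pi_ringP !pi_ring_mul mulrC.
Qed.
Fact quot_mul1 : left_id quot_one quot_mul.
Proof. by move=> x; rewrite -[x]pi_ringP !pi_ring_mul mul1r. Qed.
Fact quot_mulDl : left_distributive quot_mul +%R.
Proof.
move=> x y z; rewrite -[x]pi_ringP -[y]pi_ringP -[z]pi_ringP.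
by rewrite -pi_ringD !pi_ring_mul mulrDl pi_ringD.
Qed.
HB.instance Definition _ := GRing.Zmodule_isComPzRing.Build quot_ring
  quot_mulA quot_mulC quot_mul1 quot_mulDl.

Lemma pi_ringM a b : pi_ring (a * b) = pi_ring a * pi_ring b.
Proof. by rewrite -pi_ring_mul. Qed.

Fact pi_ring_zmod_morphism : zmod_morphism pi_ring.
Proof. by move=> a b; rewrite /pi_ring raddfB. Qed.
Fact pi_ring_monoid_morphism : monoid_morphism pi_ring.
Proof. by split=> // a b; rewrite pi_ringM. Qed.
HB.instance Definition _ :=
  GRing.isZmodMorphism.Build R quot_ring pi_ring pi_ring_zmod_morphism.
HB.instance Definition _ :=
  GRing.isMonoidMorphism.Build R quot_ring pi_ring pi_ring_monoid_morphism.

Lemma pi_ring0 a : pi_ring a = 0 <-> a \in I.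
Proof. by rewrite -(raddf0 pi_ring) eq_pi_ring subr0. Qed.

End Ring.

(* [quot_mod IN] is M / N as a module over R / I, where [IN] is a proof that
   I M is included in N. *)
Section Module.
Variables (I : ideal R) (M : lmodType R) (N : submodClosed M).

Definition quot_mod
    (IN : forall (a : R) (x : M), a \in I -> a *: x \in N) : Type :=
  Quotient.quot (submod_pred N).

Variable IN : forall (a : R) (x : M), a \in I -> a *: x \in N.
Local Notation Q := (quot_mod IN).

HB.instance Definition _ := GRing.Zmodule.on Q.

Definition pi_mod (x : M) : Q := \pi_(Quotient.quot (submod_pred N)) x.

Definition repr_mod (x : Q) : M := repr (x : Quotient.quot (submod_pred N)).

Lemma pi_modP (x : Q) : pi_mod (repr_mod x) = x.
Proof. exact: reprK. Qed.

Lemma eq_pi_mod x y : pi_mod x = pi_mod y <-> x - y \in N.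
Proof.
split=> [/eqP|xy]; first by rewrite -Quotient.idealrBE.
by apply/eqP; rewrite -Quotient.idealrBE.
Qed.

Fact pi_mod_zmod_morphism : zmod_morphism pi_mod.
Proof. by move=> a b; rewrite /pi_mod raddfB. Qed.
HB.instance Definition _ :=
  GRing.isZmodMorphism.Build M Q pi_mod pi_mod_zmod_morphism.

Lemma pi_mod0 x : pi_mod x = 0 <-> x \in N.
Proof. by rewrite -(raddf0 pi_mod) eq_pi_mod subr0. Qed.

Definition quot_scale (a : quot_ring I) (x : Q) : Q :=
  pi_mod (repr a *: repr_mod x).

Lemma pi_mod_scale a x : quot_scale (pi_ring I a) (pi_mod x) = pi_mod (a *: x).
Proof.
apply/eq_pi_mod; set a' := repr _; set x' := repr_mod _.
have Ia : a' - a \in I by apply/eq_pi_ring; rewrite pi_ringP.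
have Nx : x' - x \in N by apply/eq_pi_mod; rewrite pi_modP.
have -> : a' *: x' - a *: x = (a' - a) *: x' + a *: (x' - x).
  by rewrite scalerBl scalerBr addrA subrK.
by apply: (rpredD (IN _ Ia)); exact: (rpredZ (s := N)).
Qed.

Fact quot_scaleA a b v : quot_scale a (quot_scale b v) = quot_scale (a * b) v.
Proof.
rewrite -[a]pi_ringP -[b]pi_ringP -[v]pi_modP.
by rewrite -pi_ringM !pi_mod_scale scalerA.
Qed.
Fact quot_scale1 : left_id 1 quot_scale.
Proof.
by move=> v; rewrite -[v]pi_modP -(rmorph1 (pi_ring I)) pi_mod_scale scale1r.
Qed.
Fact quot_scaleDr : right_distributive quot_scale +%R.
Proof.
move=> a u v; rewrite -[a]pi_ringP -[u]pi_modP -[v]pi_modP.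
by rewrite -raddfD !pi_mod_scale scalerDr raddfD.
Qed.
Fact quot_scaleDl v : {morph quot_scale^~ v : a b / a + b}.
Proof.
move=> a b; rewrite /= -[a]pi_ringP -[b]pi_ringP -[v]pi_modP.
by rewrite -pi_ringD !pi_mod_scale scalerDl raddfD.
Qed.
HB.instance Definition _ := GRing.Zmodule_isLmodule.Build (quot_ring I) Q
  quot_scaleA quot_scale1 quot_scaleDr quot_scaleDl.

Lemma pi_modZ a x : pi_mod (a *: x) = pi_ring I a *: pi_mod x.
Proof. by rewrite -pi_mod_scale. Qed.

End Module.
End Quotients.

Arguments pi_mod {R I M N} IN x.
Arguments repr_mod {R I M N IN} x.

Section Rinehart.
Variable K : comPzRingType.

(* The algebraic part of a Rinehart space; finiteness, spanning and
   non-degeneracy are added in [rinehart].  The scalar k : K acts on modules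
   over [fn] as [cst k]. *)
Record preRinehart := PreRinehart {
  fn : comPzRingType;
  cst : {rmorphism K -> fn};
  tan : lmodType fn;
  cot : lmodType fn;
  pairing : tan -> cot -> fn;
  lie : tan -> tan -> tan;
  diff : fn -> cot;
  pairing_linl : forall a X Y w, pairing (a *: X + Y) w = a * pairing X w + pairing Y w;
  pairing_linr : forall a X v w, pairing X (a *: v + w) = a * pairing X v + pairing X w;
  lie_linl : forall k X Y Z,
    lie (cst k *: X + Y) Z = cst k *: lie X Z + lie Y Z;
  lie_linr : forall k X Y Z,
    lie X (cst k *: Y + Z) = cst k *: lie X Y + lie X Z;
  lie_alt : forall X, lie X X = 0;
  lie_jacobi : forall X Y Z,
    lie X (lie Y Z) + lie Y (lie Z X) + lie Z (lie X Y) = 0;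
  diff_lin : forall k f g, diff (cst k * f + g) = cst k *: diff f + diff g;
  diff_leibniz : forall f g, diff (f * g) = f *: diff g + g *: diff f;
  lie_leibniz : forall X f Y,
    lie X (f *: Y) = pairing X (diff f) *: Y + f *: lie X Y
}.

Definition dapp (A : preRinehart) (X : tan A) (f : fn A) : fn A :=
  pairing X (diff f).

Record rinehart := Rinehart {
  rinehart_pre :> preRinehart;
  tan_finite_dim : finite_dim (tan rinehart_pre);
  cot_finite_dim : finite_dim (cot rinehart_pre);
  cot_spanned : forall w : cot rinehart_pre,
    span (fun v => exists f, v = diff f) w;
  pairing_ndgl : forall X : tan rinehart_pre,
    (forall w, pairing X w = 0) -> X = 0;
  pairing_ndgr : forall w : cot rinehart_pre,
    (forall X, pairing X w = 0) -> w = 0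
}.

Record metric (A : preRinehart) := Metric {
  inner :> tan A -> tan A -> fn A;
  inner_sym : forall X Y, inner X Y = inner Y X;
  inner_linl : forall a X Y Z, inner (a *: X + Y) Z = a * inner X Z + inner Y Z
}.

Definition nondegenerate A (g : metric A) : Prop :=
  forall X, (forall Y, g X Y = 0) -> X = 0.

Definition duplicative A (g : metric A) : Prop :=
  (forall Y, exists w, forall X, pairing X w = g X Y) /\
  (forall w, exists Y, forall X, pairing X w = g X Y).

Definition musical A (g : metric A) : Prop := nondegenerate g /\ duplicative g.

Definition ordinary (A : preRinehart) : Prop :=
  forall J : ideal (fn A),
    (forall X : tan A, (forall w, pairing X w \in J) <->
       span (fun Z => exists (f : fn A) Y, f \in J /\ Z = f *: Y) X) /\
    (forall w : cot A, (forall X, pairing X w \in J) <->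
       span (fun u => exists (f : fn A) v, f \in J /\ u = f *: v) w).

Record levi_civita (A : preRinehart) (g : metric A)
    (nabla : tan A -> tan A -> tan A) : Prop := LeviCivita {
  nabla_linl : forall f X Y Z,
    nabla (f *: X + Y) Z = f *: nabla X Z + nabla Y Z;
  nabla_linr : forall k X Y Z,
    nabla X (cst A k *: Y + Z) = cst A k *: nabla X Y + nabla X Z;
  nabla_leibniz : forall X f Y,
    nabla X (f *: Y) = dapp X f *: Y + f *: nabla X Y;
  nabla_torsion : forall X Y, lie X Y = nabla X Y - nabla Y X;
  nabla_metric : forall X Y Z,
    dapp X (g Y Z) = g (nabla X Y) Z + g Y (nabla X Z)
}.

Section Pre.
Variable A : preRinehart.
Implicit Types (X Y Z : tan A) (w v : cot A) (f a : fn A).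

Lemma pair0l w : pairing (0 : tan A) w = 0.
Proof.
have := pairing_linl 1 (0 : tan A) 0 w; rewrite scaler0 addr0 mul1r => h.
by apply: (addrI (pairing (0 : tan A) w)); rewrite addr0 -h.
Qed.
Lemma pair0r X : pairing X 0 = 0.
Proof.
have := pairing_linr 1 X 0 0; rewrite scaler0 addr0 mul1r => h.
by apply: (addrI (pairing X 0)); rewrite addr0 -h.
Qed.
Lemma pairZl a X w : pairing (a *: X) w = a * pairing X w.
Proof. by rewrite -[a *: X]addr0 pairing_linl pair0l addr0. Qed.
Lemma pairZr a X w : pairing X (a *: w) = a * pairing X w.
Proof. by rewrite -[a *: w]addr0 pairing_linr pair0r addr0. Qed.
Lemma pairDl X Y w : pairing (X + Y) w = pairing X w + pairing Y w.
Proof. by rewrite -[X]scale1r pairing_linl scale1r mul1r. Qed.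
Lemma pairDr X v w : pairing X (v + w) = pairing X v + pairing X w.
Proof. by rewrite -[v]scale1r pairing_linr scale1r mul1r. Qed.
Lemma pairNl X w : pairing (- X) w = - pairing X w.
Proof. by rewrite -scaleN1r pairZl mulN1r. Qed.
Lemma pairBl X Y w : pairing (X - Y) w = pairing X w - pairing Y w.
Proof. by rewrite pairDl pairNl. Qed.
Lemma pairNr X w : pairing X (- w) = - pairing X w.
Proof. by rewrite -scaleN1r pairZr mulN1r. Qed.
Lemma pair_suml n (s : 'I_n -> tan A) w :
  pairing (\sum_i s i) w = \sum_i pairing (s i) w.
Proof.
by apply: (big_morph (fun x => pairing x w)) => [x y|]; rewrite ?pairDl ?pair0l.
Qed.

Lemma lieDl X Y Z : lie (X + Y) Z = lie X Z + lie Y Z.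
Proof. by have := lie_linl 1 X Y Z; rewrite rmorph1 !scale1r. Qed.
Lemma lieDr X Y Z : lie X (Y + Z) = lie X Y + lie X Z.
Proof. by have := lie_linr 1 X Y Z; rewrite rmorph1 !scale1r. Qed.
Lemma lieC X Y : lie X Y = - lie Y X.
Proof.
apply/eqP; rewrite -addr_eq0; apply/eqP.
by have := lie_alt (X + Y); rewrite lieDl !lieDr !lie_alt add0r addr0.
Qed.
Lemma lie0r X : lie X 0 = 0.
Proof. by apply: (addrI (lie X 0)); rewrite -lieDr !addr0. Qed.
Lemma lieNr X Y : lie X (- Y) = - lie X Y.
Proof. by apply: (addrI (lie X Y)); rewrite -lieDr !subrr lie0r. Qed.
Lemma lieNl X Y : lie (- X) Y = - lie X Y.
Proof. by rewrite lieC lieNr [lie Y X]lieC opprK. Qed.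

Lemma diffD f1 f2 : diff (f1 + f2) = diff f1 + diff f2 :> cot A.
Proof. by have := diff_lin (p := A) 1 f1 f2; rewrite rmorph1 mul1r scale1r. Qed.

Lemma dappM X f1 f2 : dapp X (f1 * f2) = f1 * dapp X f2 + f2 * dapp X f1.
Proof. by rewrite /dapp diff_leibniz pairDr !pairZr. Qed.
Lemma dappD X f1 f2 : dapp X (f1 + f2) = dapp X f1 + dapp X f2.
Proof. by rewrite /dapp diffD pairDr. Qed.

Definition curv X Y f : fn A :=
  dapp (lie X Y) f - (dapp X (dapp Y f) - dapp Y (dapp X f)).

Lemma curv_kill X Y f Z : curv X Y f *: Z = 0.
Proof.
have jac (U V W : tan A) : lie U (lie V W) = lie (lie U V) W + lie V (lie U W).
  have := lie_jacobi U V W; rewrite (lieC W (lie U V)) (lieC W U) lieNr => /eqP.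
  by rewrite subr_eq0 subr_eq addrC => /eqP.
have hZ := jac X Y Z.
have := jac X Y (f *: Z); rewrite !lie_leibniz !lieDr !lie_leibniz -!/(dapp _ _) hZ !scalerDr => h.
rewrite /curv !scalerBl.
move: h; rewrite [RHS](AC (2*(2*2)) ((1*3)*5*(4*(2*6)))) => /addIr/addIr ->.
by rewrite addrK subrr.
Qed.
End Pre.

(* A Nakayama argument: if a kills the tangent space of an ordinary space, then
   every X is killed by some p with a p = a ([killed_modulo]).  Applied to
   a = curv X Y f, this gives a = 0: the anchor X |-> dapp X is a Lie morphism,
   which is not among the axioms. *)
Lemma annihilate (R : comPzRingType) (a : R) n : forall (u : R)
    (f : nat -> R) (q : nat -> nat -> R), a * u = a ->
  (forall k j, a * q k j = 0) ->
  (forall k, (k < n)%N -> u * f k = \sum_(j < n) q k j * f j) ->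
  exists2 v, a * v = a & forall k, (k < n)%N -> v * f k = 0.
Proof.
elim: n => [|n IHn] u f q au aq uf; first by exists 1; rewrite ?mulr1.
pose u' := u - q n n.
have au' : a * u' = a by rewrite mulrBr aq au subr0.
have u'f : u' * f n = \sum_(j < n) q n j * f j.
  by rewrite mulrBl uf // big_ord_recr /= addrK.
clearbody u'; have [||k kn|v av vf] := IHn (u' * u) f (fun k j => u' * q k j + q k n * q n j).
- by rewrite mulrA au'.
- by move=> k j; rewrite mulrDr mulrCA aq mulr0 mulrA aq mul0r addr0.
- rewrite -mulrA uf; last exact: ltnW.
  rewrite big_ord_recr /= mulrDr.
  rewrite [u' * (_ * _)]mulrCA u'f !mulr_sumr -big_split /=.
  by apply: eq_bigr => j _; rewrite mulrDl !mulrA.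
exists (v * u'); first by rewrite mulrA av.
move=> k; rewrite ltnS leq_eqVlt => /predU1P[->|kn].
  rewrite -mulrA u'f mulr_sumr big1 // => j _.
  by rewrite mulrCA vf // mulr0.
by rewrite mulrAC vf // mul0r.
Qed.

Section Anchor.
Variables (A : rinehart) (ordA : ordinary A).
Implicit Types (X Y Z : tan A) (w v : cot A) (f a : fn A).

Definition pair_ideal X : {pred (fn A)^o} := fun f => `[< exists w, pairing X w = f >].

Fact pair_ideal_closed X : GRing.submod_closed (pair_ideal X).
Proof.
split; first by apply/asboolP; exists 0; rewrite pair0r.
move=> a f1 f2 /asboolP[w1 <-] /asboolP[w2 <-].
by apply/asboolP; exists (a *: w1 + w2); rewrite pairing_linr.
Qed.
HB.instance Definition _ X :=
  GRing.isSubmodClosed.Build _ _ (pair_ideal X) (pair_ideal_closed X).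

Lemma killed_modulo a X : (forall Z, a *: Z = 0) ->
  exists2 p, a * p = a & p *: X = 0.
Proof.
move=> aZ.
have [n [b [s [sP eX]]]] := ((ordA (pair_ideal X)).1 X).1
  (fun w => asboolT (ex_intro _ w erefl)).
have /choice[Yw YwP] i : exists Yw, s i = pairing X Yw.2 *: Yw.1.
  have [f [Y [/asboolP[w <-] ->]]] := sP i.
  by exists (Y, w).
pose c i := pairing X (Yw i).2.
pose q (k j : 'I_n) := b j * pairing (Yw j).1 (Yw k).2.
pose C k : fn A := oapp c 0 (insub k).
pose Q k j : fn A := oapp (fun k' => oapp (q k') 0 (insub j)) 0 (insub k).
have [||k kn|v av vC] := @annihilate _ a n 1 C Q.
- by rewrite mulr1.
- move=> k j; rewrite /Q; case: (insub k) => [k'|] /=; last by rewrite mulr0.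
  case: (insub j) => [j'|] /=; last by rewrite mulr0.
  by rewrite /q mulrCA -pairZl aZ pair0l mulr0.
- rewrite mul1r /C /Q (insubT (fun k => k < n)%N kn) /= /c {1}eX pair_suml.
  apply: eq_bigr => j _; rewrite valK /= YwP !pairZl /q /c.
  by rewrite mulrA mulrAC.
exists v => //; rewrite {1}eX scaler_sumr big1 // => i _.
have := vC i (ltn_ord i); rewrite /C valK /= YwP => vci.
by rewrite !scalerA mulrAC vci mul0r scale0r.
Qed.

Lemma anchor X Y f :
  dapp (lie X Y) f = dapp X (dapp Y f) - dapp Y (dapp X f).
Proof.
apply/eqP; rewrite -subr_eq0 -/(curv X Y f); apply/eqP.
have aZ := curv_kill X Y f.
have [p ap pX] := killed_modulo X aZ.
have [q aq qY] := killed_modulo Y aZ.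
have [r ar rW] := killed_modulo (lie X Y) aZ.
rewrite -ap -aq -ar /curv /dapp.
have k Z w t : t *: Z = 0 -> pairing Z w * t = 0.
  by move=> tZ; rewrite mulrC -pairZl tZ pair0l.
rewrite !mulrBl (k (lie X Y) _ r) // !mul0r.
rewrite (mulrAC (pairing Y _) r q) (k Y _ q) // !mul0r.
by rewrite (mulrAC _ q p) (mulrAC _ r p) (k X _ p) // !mul0r !subr0.
Qed.
End Anchor.

Section Quotient.
Variables (A : rinehart) (I : ideal (fn A)).
Implicit Types (X Y Z : tan A) (w v : cot A) (f a : fn A).

(* [cot_bot], [tan_top], [tan_zero] are the submodules of A with exponents
   bot, top and 0; the quotients by [tan_zero] and [cot_bot] are [tanC], with
   submodule [tanCT] (the image of [tan_top]), and [cotCT]. *)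
Definition cot_bot : {pred cot A} :=
  fun w => `[< span (fun v => exists2 f, f \in I & v = diff f) w >].

Definition tan_top : {pred tan A} :=
  fun X => `[< forall w, w \in cot_bot -> pairing X w \in I >].

Definition tan_zero : {pred tan A} :=
  fun X => `[< forall w, pairing X w \in I >].

Fact cot_bot_closed : GRing.submod_closed cot_bot.
Proof.
split; first by apply/asboolP; apply: span0.
by move=> a u v /asboolP ? /asboolP ?; apply/asboolP; apply: spanZD.
Qed.
HB.instance Definition _ :=
  GRing.isSubmodClosed.Build _ _ cot_bot cot_bot_closed.

Fact tan_top_closed : GRing.submod_closed tan_top.
Proof.
split; first by apply/asboolP => w _; rewrite pair0l; apply: (rpred0 I).
move=> a u v /asboolP hu /asboolP hv; apply/asboolP => w hw.
by rewrite pairing_linl; apply: (rpredD (idealM _ (hu _ hw)) (hv _ hw)).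
Qed.
HB.instance Definition _ :=
  GRing.isSubmodClosed.Build _ _ tan_top tan_top_closed.

Fact tan_zero_closed : GRing.submod_closed tan_zero.
Proof.
split; first by apply/asboolP => w; rewrite pair0l; apply: (rpred0 I).
move=> a u v /asboolP hu /asboolP hv; apply/asboolP => w.
by rewrite pairing_linl; apply: (rpredD (idealM _ (hu _)) (hv _)).
Qed.
HB.instance Definition _ :=
  GRing.isSubmodClosed.Build _ _ tan_zero tan_zero_closed.

Lemma tan_topP X : X \in tan_top <-> forall f, f \in I -> dapp X f \in I.
Proof.
split=> [/asboolP XT f If|XI].
  by apply: XT; apply/asboolP; apply: span_gen; exists f.
apply/asboolP => w /asboolP; elim/span_ind: w / => [|u v|a _ [f If ->]].
- by rewrite pair0r; apply: (rpred0 I).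
- by rewrite pairDr => Iu Iv; apply: (rpredD Iu Iv).
- by rewrite pairZr; apply: idealM; apply: XI.
Qed.

Lemma tan_zero_top X : X \in tan_zero -> X \in tan_top.
Proof. by move=> /asboolP X0; apply/asboolP. Qed.

Lemma tan_zero_ann a X : a \in I -> a *: X \in tan_zero.
Proof.
by move=> Ia; apply/asboolP => w; rewrite pairZl mulrC; apply: idealM.
Qed.

Lemma cot_bot_ann a w : a \in I -> a *: w \in cot_bot.
Proof.
move=> Ia; elim/span_ind: w / (cot_spanned w) => [|u v|b _ [f ->]].
- by rewrite scaler0; apply: (rpred0 cot_bot).
- by rewrite scalerDr => hu hv; apply: (rpredD hu hv).
rewrite scalerA mulrC -scalerA; apply: (rpredZ (s := cot_bot)).
have -> : a *: diff f = diff (f * a) - f *: diff a :> cot A.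
  by rewrite diff_leibniz addrC addKr.
rewrite -scaleNr addrC; apply/asboolP; apply: spanZD; apply: span_gen.
  by exists a.
by exists (f * a) => //; apply: idealM.
Qed.

Definition fnC : comPzRingType := quot_ring I.
Definition tanC : lmodType fnC := quot_mod tan_zero_ann.
Definition cotCT : lmodType fnC := quot_mod cot_bot_ann.
Definition rho_star : {rmorphism fn A -> fnC} := pi_ring I.
Definition rho_sharp : {additive tan A -> tanC} := pi_mod tan_zero_ann.

Definition tanC_top : {pred tanC} :=
  fun x => `[< exists2 X, X \in tan_top & x = rho_sharp X >].

Fact tanC_top_closed : GRing.submod_closed tanC_top.
Proof.
split; first by apply/asboolP; exists 0; rewrite ?raddf0 // (rpred0 tan_top).
move=> a _ _ /asboolP[X XT ->] /asboolP[Y YT ->]; apply/asboolP.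
exists (repr a *: X + Y); first exact: (rpredD (rpredZ _ XT) YT).
by rewrite raddfD; congr (_ + _); rewrite -{1}[a]pi_ringP -pi_modZ.
Qed.
HB.instance Definition _ :=
  GRing.isSubmodClosed.Build _ _ tanC_top tanC_top_closed.

Record tanCT_type := TanCT { tanCT_val :> tanC; _ : tanCT_val \in tanC_top }.
HB.instance Definition _ := [isSub for tanCT_val].
HB.instance Definition _ := [Choice of tanCT_type by <:].
HB.instance Definition _ := [SubChoice_isSubLmodule of tanCT_type by <:].
Definition tanCT : lmodType fnC := tanCT_type.

Lemma tanC_topP X : X \in tan_top -> rho_sharp X \in tanC_top.
Proof. by move=> XT; apply/asboolP; exists X. Qed.

Definition rho_top X (XT : X \in tan_top) : tanCT := TanCT (tanC_topP XT).

Lemma repr_top (x : tanCT_type) : repr_mod (tanCT_val x) \in tan_top.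
Proof.
case: x => x /= xT; have /asboolP[X XT ex] := xT.
rewrite -[repr_mod x](subrK X); apply: (rpredD (S := tan_top) _ XT).
by apply: tan_zero_top; apply/(eq_pi_mod tan_zero_ann); rewrite pi_modP ex.
Qed.

Lemma rho_topP (x : tanCT) : rho_top (repr_top x) = x.
Proof. by apply: val_inj; exact: pi_modP. Qed.

Lemma eq_rho_top X Y (XT : X \in tan_top) (YT : Y \in tan_top) :
  X - Y \in tan_zero -> rho_top XT = rho_top YT.
Proof. by move=> XY; apply: val_inj; apply/eq_pi_mod. Qed.

Lemma rho_topZ a X (XT : X \in tan_top) (aXT : a *: X \in tan_top) :
  rho_top aXT = rho_star a *: rho_top XT.
Proof. by apply: val_inj; exact: (pi_modZ tan_zero_ann). Qed.

Lemma rho_topD X Y (XT : X \in tan_top) (YT : Y \in tan_top)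
  (XYT : X + Y \in tan_top) : rho_top XYT = rho_top XT + rho_top YT.
Proof. by apply: val_inj; exact: (raddfD rho_sharp). Qed.

Lemma rho_top0 X (XT : X \in tan_top) : X = 0 -> rho_top XT = 0.
Proof. by move=> X0; apply: val_inj; rewrite /= X0 raddf0. Qed.

(* Induced operations are computed on representatives; the lemmas pairCTE,
   diffCTE, lieCTE, innerCE, nablaCE and projCE show that the result does not
   depend on their choice. *)

Definition pairCT (x : tanCT) (w : cotCT) : fnC :=
  rho_star (pairing (repr_mod (tanCT_val x)) (repr_mod w)).

Definition diffCT (f : fnC) : cotCT := pi_mod cot_bot_ann (diff (repr f)).

Lemma pairCTE X (XT : X \in tan_top) w :
  pairCT (rho_top XT) (pi_mod cot_bot_ann w) = rho_star (pairing X w).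
Proof.
apply/eq_pi_ring; set X' := repr_mod _; set w' := repr_mod _.
have hX : X' - X \in tan_zero by apply/(eq_pi_mod tan_zero_ann); rewrite pi_modP.
have hw : w' - w \in cot_bot by apply/(eq_pi_mod cot_bot_ann); rewrite pi_modP.
have -> : pairing X' w' - pairing X w = pairing (X' - X) w' + pairing X (w' - w).
  by rewrite pairBl pairDr pairNr addrA subrK.
by apply: rpredD; [have /asboolP := hX | have /asboolP := XT]; apply.
Qed.

Lemma diffCTE f : diffCT (rho_star f) = pi_mod cot_bot_ann (diff f).
Proof.
apply/eq_pi_mod; set f' := repr _.
have If : f' - f \in I by apply/(eq_pi_ring I); rewrite pi_ringP.
rewrite -[X in diff X - _](subrK f) diffD addrK.
by apply/asboolP; apply: span_gen; exists (f' - f).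
Qed.

Section Ordinary.
Hypothesis ordA : ordinary A.

Lemma tan_zero_span X : X \in tan_zero ->
  span (fun Z => exists (f : fn A) Y, f \in I /\ Z = f *: Y) X.
Proof. by move/asboolP/(ordA I).1. Qed.

Lemma lie_top X Y : X \in tan_top -> Y \in tan_top -> lie X Y \in tan_top.
Proof.
move=> /tan_topP XT /tan_topP YT; apply/tan_topP => f If.
by rewrite (anchor ordA); apply: (rpredD (XT _ (YT _ If)));
  rewrite -mulN1r; apply: idealM; apply: YT; apply: XT.
Qed.

Lemma lie_zero X Y : X \in tan_top -> Y \in tan_zero -> lie X Y \in tan_zero.
Proof.
move=> /tan_topP XT /tan_zero_span; elim/span_ind: Y /.
- by rewrite lie0r; apply: (rpred0 tan_zero).
- by move=> Y Z hY hZ; rewrite lieDr; apply: (rpredD hY hZ).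
move=> a _ [f [Y [If ->]]]; rewrite scalerA lie_leibniz.
have Iaf : a * f \in I by exact: idealM.
by apply: (rpredD (S := tan_zero)); apply: tan_zero_ann => //; apply: XT.
Qed.

Definition lieCT (x y : tanCT) : tanCT :=
  rho_top (lie_top (repr_top x) (repr_top y)).

Lemma lieCTE X Y (XT : X \in tan_top) (YT : Y \in tan_top) :
  lieCT (rho_top XT) (rho_top YT) = rho_top (lie_top XT YT).
Proof.
apply: eq_rho_top; set X' := repr_mod _; set Y' := repr_mod _.
have hX : X' - X \in tan_zero by apply/(eq_pi_mod tan_zero_ann); rewrite pi_modP.
have hY : Y' - Y \in tan_zero by apply/(eq_pi_mod tan_zero_ann); rewrite pi_modP.
have -> : lie X' Y' - lie X Y = lie X' (Y' - Y) - lie Y (X' - X).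
  rewrite !lieDr !lieNr (lieC X Y) (lieC X' Y) opprD !opprK addrA.
  by rewrite addrK.
rewrite -(scaleN1r (lie Y _)); apply: (rpredD (S := tan_zero)).
  by apply: lie_zero => //; exact: (repr_top (rho_top XT)).
by apply: (rpredZ (s := tan_zero)); apply: lie_zero.
Qed.


Fact rho_topEx (x : tanCT) : exists X (XT : X \in tan_top), x = rho_top XT.
Proof. by exists _, (repr_top x); rewrite rho_topP. Qed.
Fact fnCEx (f : fnC) : exists g, f = rho_star g.
Proof. by exists (repr f); rewrite /= pi_ringP. Qed.
Fact cotCTEx (w : cotCT) : exists v, w = pi_mod cot_bot_ann v.
Proof. by exists (repr_mod w); rewrite pi_modP. Qed.

Definition cstC : {rmorphism K -> fnC} := rho_star \o cst A.

Fact pairCT_linl (a : fnC) (x y : tanCT) (w : cotCT) :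
  pairCT (a *: x + y) w = a * pairCT x w + pairCT y w.
Proof.
have [b ->] := fnCEx a; have [X [XT ->]] := rho_topEx x.
have [Y [YT ->]] := rho_topEx y; have [v ->] := cotCTEx w.
have bXT : b *: X \in tan_top by apply: (rpredZ (s := tan_top)).
have bXYT : b *: X + Y \in tan_top by apply: (rpredD bXT YT).
rewrite -(rho_topZ XT bXT) -(rho_topD bXT YT bXYT) !pairCTE.
by rewrite pairing_linl rmorphD rmorphM.
Qed.
Fact pairCT_linr (a : fnC) (x : tanCT) (v w : cotCT) :
  pairCT x (a *: v + w) = a * pairCT x v + pairCT x w.
Proof.
have [b ->] := fnCEx a; have [X [XT ->]] := rho_topEx x.
have [v' ->] := cotCTEx v; have [w' ->] := cotCTEx w.
rewrite -[rho_star b *: _](pi_modZ cot_bot_ann) -(raddfD (pi_mod _)) !pairCTE.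
by rewrite pairing_linr rmorphD rmorphM.
Qed.
Fact lieCT_linr k (x y z : tanCT) :
  lieCT x (cstC k *: y + z) = cstC k *: lieCT x y + lieCT x z.
Proof.
have [X [XT ->]] := rho_topEx x; have [Y [YT ->]] := rho_topEx y.
have [Z [ZT ->]] := rho_topEx z.
have kYT : cst A k *: Y \in tan_top by apply: (rpredZ (s := tan_top)).
have kYZT : cst A k *: Y + Z \in tan_top by apply: (rpredD kYT ZT).
rewrite -(rho_topZ YT kYT) -(rho_topD kYT ZT kYZT) !lieCTE.
have LT : cst A k *: lie X Y \in tan_top.
  by apply: (rpredZ (s := tan_top)); apply: lie_top.
have LLT : cst A k *: lie X Y + lie X Z \in tan_top.
  by apply: (rpredD LT (lie_top XT ZT)).
rewrite -(rho_topZ _ LT) -(rho_topD LT _ LLT).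
by apply: eq_rho_top; rewrite lie_linr subrr (rpred0 tan_zero).
Qed.
Fact lieCT_alt (x : tanCT) : lieCT x x = 0.
Proof.
have [X [XT ->]] := rho_topEx x; rewrite lieCTE; apply: rho_top0.
exact: lie_alt.
Qed.
Fact lieCT_linl k (x y z : tanCT) :
  lieCT (cstC k *: x + y) z = cstC k *: lieCT x z + lieCT y z.
Proof.
have alt (u v : tanCT) : lieCT u v = - lieCT v u.
  have D (r s t : tanCT) : lieCT r (s + t) = lieCT r s + lieCT r t.
    by have := lieCT_linr 1 r s t; rewrite rmorph1 !scale1r.
  have [U [UT ->]] := rho_topEx u; have [V [VT ->]] := rho_topEx v.
  rewrite !lieCTE; apply: val_inj; rewrite raddfN /= -raddfN.
  by congr (pi_mod _ _); rewrite lieC.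
by rewrite alt lieCT_linr opprD -scalerN -!alt.
Qed.
Fact lieCT_jacobi x y z :
  lieCT x (lieCT y z) + lieCT y (lieCT z x) + lieCT z (lieCT x y) = 0.
Proof.
have [X [XT ->]] := rho_topEx x; have [Y [YT ->]] := rho_topEx y.
have [Z [ZT ->]] := rho_topEx z.
rewrite !lieCTE; apply: val_inj; rewrite !raddfD raddf0 /= -!raddfD.
by rewrite lie_jacobi raddf0.
Qed.
Fact diffCT_lin k (f g : fnC) :
  diffCT (cstC k * f + g) = cstC k *: diffCT f + diffCT g.
Proof.
have [f' ->] := fnCEx f; have [g' ->] := fnCEx g.
have -> : cstC k * rho_star f' + rho_star g' = rho_star (cst A k * f' + g').
  by rewrite rmorphD rmorphM.
rewrite !diffCTE diff_lin raddfD; congr (_ + _).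
exact: (pi_modZ cot_bot_ann).
Qed.
Fact diffCT_leibniz (f g : fnC) : diffCT (f * g) = f *: diffCT g + g *: diffCT f.
Proof.
have [f' ->] := fnCEx f; have [g' ->] := fnCEx g.
rewrite -rmorphM !diffCTE diff_leibniz raddfD.
by congr (_ + _); exact: (pi_modZ cot_bot_ann).
Qed.
Fact lieCT_leibniz (x : tanCT) (f : fnC) (y : tanCT) :
  lieCT x (f *: y) = pairCT x (diffCT f) *: y + f *: lieCT x y.
Proof.
have [X [XT ->]] := rho_topEx x; have [Y [YT ->]] := rho_topEx y.
have [g ->] := fnCEx f.
have gYT : g *: Y \in tan_top by apply: (rpredZ (s := tan_top)).
rewrite -(rho_topZ YT gYT) diffCTE pairCTE !lieCTE; apply: val_inj.
rewrite raddfD /= lie_leibniz raddfD.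
by congr (_ + _); exact: (pi_modZ tan_zero_ann).
Qed.

(* C^T is only a [preRinehart] because the pairing it inherits may degenerate
   on the cotangent side: for K = Z, functions Z[x], tangent and cotangent
   spaces free on d/dx and dx, and I = (x^2 + 1), the tangent space of C^T is 0
   while its cotangent space is Z[i] / (2).  Levi-Civita connections only
   involve the [preRinehart] structure. *)
Definition quotient_space : preRinehart := PreRinehart
  pairCT_linl pairCT_linr lieCT_linl lieCT_linr lieCT_alt lieCT_jacobi
  diffCT_lin diffCT_leibniz lieCT_leibniz.

Section Metric.
Variable g : metric A.

Lemma inner_zero X Y : X \in tan_zero -> g X Y \in I.
Proof.
have D a U V : g (a *: U + V) Y = a * g U Y + g V Y by exact: inner_linl.
have g0 : g 0 Y = 0.
  by have := D (-1) 0 0; rewrite scaler0 addr0 mulN1r addNr.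
move=> /tan_zero_span; elim/span_ind: X /.
- by rewrite g0; apply: (rpred0 I).
- by move=> U V gU gV; rewrite -[U]scale1r D mul1r; apply: (rpredD gU gV).
move=> a _ [f [Z [If ->]]]; rewrite scalerA -[_ *: Z]addr0 D g0 addr0 mulrC.
by apply: idealM; apply: idealM.
Qed.

Definition innerC (x y : tanC) : fnC := rho_star (g (repr_mod x) (repr_mod y)).

Lemma innerCE X Y : innerC (rho_sharp X) (rho_sharp Y) = rho_star (g X Y).
Proof.
apply/eq_pi_ring; set X' := repr_mod _; set Y' := repr_mod _.
have hX : X' - X \in tan_zero by apply/(eq_pi_mod tan_zero_ann); rewrite pi_modP.
have hY : Y' - Y \in tan_zero by apply/(eq_pi_mod tan_zero_ann); rewrite pi_modP.
have -> : g X' Y' - g X Y = g (X' - X) Y' + g (Y' - Y) X.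
  have B U V Z : g (U - V) Z = g U Z - g V Z.
    by rewrite addrC -scaleN1r inner_linl mulN1r addrC.
  by rewrite !B ![g _ X]inner_sym (inner_sym g X Y') addrA subrK.
by apply: rpredD; apply: inner_zero.
Qed.

Definition innerCT (x y : tanCT) : fnC := innerC (tanCT_val x) (tanCT_val y).

Fact innerCT_sym x y : innerCT x y = innerCT y x.
Proof. by rewrite /innerCT /innerC inner_sym. Qed.

Fact innerCT_linl (a : fnC) (x y z : tanCT) :
  innerCT (a *: x + y) z = a * innerCT x z + innerCT y z.
Proof.
have [b ->] := fnCEx a; have [X [XT ->]] := rho_topEx x.
have [Y [YT ->]] := rho_topEx y; have [Z [ZT ->]] := rho_topEx z.
have bXT : b *: X \in tan_top by apply: (rpredZ (s := tan_top)).
have bXYT : b *: X + Y \in tan_top by apply: (rpredD bXT YT).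
rewrite -(rho_topZ XT bXT) -(rho_topD bXT YT bXYT) /innerCT !innerCE.
by rewrite inner_linl rmorphD rmorphM.
Qed.

Definition quotient_metric : metric quotient_space :=
  @Metric quotient_space innerCT innerCT_sym innerCT_linl.

End Metric.

End Ordinary.
Definition nablaC (nabla : tan A -> tan A -> tan A) (x : tanCT) (y : tanC) :
    tanC :=
  rho_sharp (nabla (repr_mod (tanCT_val x)) (repr_mod y)).

Lemma nablaCE (ordA : ordinary A) (g : metric A) nabla X Y
    (XT : X \in tan_top) : levi_civita g nabla ->
  nablaC nabla (rho_top XT) (rho_sharp Y) = rho_sharp (nabla X Y).
Proof.
move=> LC; have L := nabla_linl LC.
have LR U V W : nabla U (V + W) = nabla U V + nabla U W.
  by have := nabla_linr LC 1 U V W; rewrite rmorph1 !scale1r.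
have L0 V : nabla 0 V = 0.
  by have := L (-1) 0 0 V; rewrite scaler0 addr0 scaleN1r addNr.
have R0 U : nabla U 0 = 0.
  by apply: (addrI (nabla U 0)); rewrite -LR !addr0.
apply/eq_pi_mod; set X' := repr_mod _; set Y' := repr_mod _.
have hX : X' - X \in tan_zero by apply/(eq_pi_mod tan_zero_ann); rewrite pi_modP.
have hY : Y' - Y \in tan_zero by apply/(eq_pi_mod tan_zero_ann); rewrite pi_modP.
have -> : nabla X' Y' - nabla X Y = nabla (X' - X) Y' + nabla X (Y' - Y).
  have BL U V W : nabla (U - V) W = nabla U W - nabla V W.
    by rewrite addrC -scaleN1r L scaleN1r addrC.
  have BR U V W : nabla U (V - W) = nabla U V - nabla U W.
    by apply/eqP; rewrite eq_sym subr_eq -LR subrK.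
  by rewrite BL BR addrA subrK.
apply: (rpredD (S := tan_zero)).
  elim/span_ind: (X' - X) / (tan_zero_span ordA hX) => [|U V|a _ [f [Z [If ->]]]].
  - by rewrite L0; apply: (rpred0 tan_zero).
  - by rewrite -[U]scale1r L !scale1r => hU hV; apply: (rpredD hU hV).
  rewrite scalerA -[_ *: Z]addr0 L L0 addr0; apply: tan_zero_ann.
  exact: idealM.
elim/span_ind: (Y' - Y) / (tan_zero_span ordA hY) => [|U V|a _ [f [Z [If ->]]]].
- by rewrite R0; apply: (rpred0 tan_zero).
- by rewrite LR => hU hV; apply: (rpredD hU hV).
have Iaf : a * f \in I by exact: idealM.
rewrite scalerA (nabla_leibniz LC).
by apply: (rpredD (S := tan_zero)); apply: tan_zero_ann => //;
  move/tan_topP: (XT); apply.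
Qed.

Record projection (g : metric A) := Projection {
  proj :> {linear tan A -> tan A};
  proj_top : forall Y, proj Y \in tan_top;
  proj_mod : forall X Y, X \in tan_top -> g X (proj Y) - g X Y \in I
}.

Definition projC (g : metric A) (p : projection g) (x : tanC) : tanCT :=
  rho_top (proj_top p (repr_mod x)).

Lemma projCE (ordA : ordinary A) (g : metric A) (p : projection g) X :
  projC p (rho_sharp X) = rho_top (proj_top p X).
Proof.
apply: eq_rho_top; set X' := repr_mod _.
have hX : X' - X \in tan_zero by apply/(eq_pi_mod tan_zero_ann); rewrite pi_modP.
have -> : p X' - p X = p (X' - X) by rewrite raddfB.
elim/span_ind: (X' - X) / (tan_zero_span ordA hX) => [|U V|a _ [f [Z [If ->]]]].
- by rewrite raddf0; apply: (rpred0 tan_zero).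
- by rewrite raddfD => hU hV; apply: (rpredD hU hV).
by rewrite scalerA linearZ; apply: tan_zero_ann; apply: idealM.
Qed.

End Quotient.
End Rinehart.

(* Main.v *)
Require Import Defs.
From mathcomp Require Import all_boot all_algebra.
From mathcomp Require Import boolp.

(** Composing the projection with the quotient map gives a map [rho_proj]
    from the tangent space of A onto the tangent space of C^T.  It is linear
    over the quotient map of function spaces, and the induced connection is
    nabla^T_(P X) (P Y) = P (nabla_X Y) for X and Y in [tan_top], where P is
    [rho_proj].  Every axiom for nabla^T is therefore the image under P of the
    same axiom for nabla, as soon as P is compatible with the rest of the
    structure.

    The compatibility that needs an argument is that P restricts to the
    quotient map on [tan_top], that is, that a vector Y of [tan_top] and its
    projection agree modulo [tan_zero] ([proj_id_mod]).  Without it the term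
    (d_X f) Y of the Leibniz rule and the bracket in the torsion identity,
    which are already tangent, would be altered by the projection.  The
    difference Z = Y^T - Y is tangent and orthogonal modulo I to [tan_top].
    The defining property of the projection then makes Z orthogonal modulo I
    to every vector W, since <Z, W> = <Z, W^T> modulo I.  Because the metric is
    duplicative, every covector is the product with some vector W, so
    <Z, w> lies in I for every covector w, which is membership in
    [tan_zero].

    Compatibility with the metric involves vectors that are not tangent, such
    as nabla_X Y, but always paired with a tangent one ([inner_rho_proj]). *)

Set Implicit Arguments.
Unset Strict Implicit.
Unset Printing Implicit Defensive.

Import GRing.Theory.
Local Open Scope ring_scope.

Section Projection.
Variables (K : comPzRingType) (A : rinehart K) (g : metric A).
Variables (I : ideal (fn A)) (p : projection I g) (ordA : ordinary A).
Implicit Types (X Y Z W : tan A) (f : fn A).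

Lemma innerBl X Y Z : g (X - Y) Z = g X Z - g Y Z.
Proof. by rewrite addrC -scaleN1r inner_linl mulN1r addrC. Qed.

(** Duality turns orthogonality modulo I into vanishing modulo I: the
    projection moves an arbitrary second argument into [tan_top]. *)
Lemma tan_zero_orthogonal Z : duplicative g -> Z \in tan_top I ->
  (forall X, X \in tan_top I -> g X Z \in I) -> Z \in tan_zero I.
Proof.
move=> [_ dup] ZT Zorth; apply/asboolP => w.
have [W ->] := dup w.
rewrite -[g Z W](subKr (g Z (p W))) [X in X - _]inner_sym.
apply: (rpredB (S := submod_pred I)); first by apply: Zorth; exact: proj_top.
exact: proj_mod.
Qed.

Lemma proj_id_mod Y : duplicative g -> Y \in tan_top I ->
  p Y - Y \in tan_zero I.
Proof.
move=> dup YT; apply: tan_zero_orthogonal => // [|X XT].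
  exact: (rpredB (S := submod_pred (tan_top I)) (proj_top p Y) YT).
by rewrite inner_sym innerBl -!(inner_sym g X); exact: proj_mod.
Qed.

Definition rho_proj X : tanCT I := rho_top (proj_top p X).

Lemma rho_projP a X Y :
  rho_proj (a *: X + Y) = rho_star I a *: rho_proj X + rho_proj Y.
Proof.
have aXT : a *: p X \in tan_top I.
  by apply: (rpredZ (s := tan_top I)); apply: proj_top.
have aXYT : a *: p X + p Y \in tan_top I by apply: (rpredD aXT (proj_top p Y)).
rewrite -(rho_topZ (proj_top p X) aXT) -(rho_topD aXT _ aXYT).
by apply: eq_rho_top; rewrite linearP subrr (rpred0 (tan_zero I)).
Qed.

Lemma rho_projD X Y : rho_proj (X + Y) = rho_proj X + rho_proj Y.
Proof. by rewrite -[X]scale1r rho_projP rmorph1 !scale1r. Qed.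

Lemma rho_projZ a X : rho_proj (a *: X) = rho_star I a *: rho_proj X.
Proof. by apply: (addIr (rho_proj X)); rewrite -rho_projD rho_projP. Qed.

Lemma rho_projB X Y : rho_proj (X - Y) = rho_proj X - rho_proj Y.
Proof. by apply/eqP; rewrite eq_sym subr_eq -rho_projD subrK. Qed.

(** Since Y is tangent, replacing X by its projection changes <X, Y> only by
    an element of I. *)
Lemma inner_rho_proj X Y (YT : Y \in tan_top I) :
  innerCT g (rho_proj X) (rho_top YT) = rho_star I (g X Y).
Proof.
rewrite /innerCT (innerCE I ordA g (p X) Y).
by apply/eq_pi_ring; rewrite !(inner_sym g _ Y); apply: proj_mod.
Qed.

Hypothesis dup : duplicative g.

Lemma rho_proj_top Y (YT : Y \in tan_top I) : rho_proj Y = rho_top YT.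
Proof. by apply: eq_rho_top; exact: proj_id_mod. Qed.

Section Connection.
Variable nabla : tan A -> tan A -> tan A.
Hypothesis LC : levi_civita g nabla.

Definition nabla_top (x y : tanCT I) : tanCT I :=
  projC p (nablaC nabla x (tanCT_val y)).

Lemma nabla_topE X Y (XT : X \in tan_top I) (YT : Y \in tan_top I) :
  nabla_top (rho_top XT) (rho_top YT) = rho_proj (nabla X Y).
Proof. by rewrite /nabla_top (nablaCE ordA Y XT LC) (projCE ordA). Qed.

Lemma nabla_top_linl (f : fnC I) (x y z : tanCT I) :
  nabla_top (f *: x + y) z = f *: nabla_top x z + nabla_top y z.
Proof.
have [a ->] := fnCEx f; have [X [XT ->]] := rho_topEx x.
have [Y [YT ->]] := rho_topEx y; have [Z [ZT ->]] := rho_topEx z.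
have aXT : a *: X \in tan_top I by apply: (rpredZ (s := tan_top I)).
have aXYT : a *: X + Y \in tan_top I by apply: (rpredD aXT YT).
rewrite -(rho_topZ XT aXT) -(rho_topD aXT YT aXYT) !nabla_topE.
by rewrite (nabla_linl LC) rho_projP.
Qed.

Lemma nabla_top_linr k (x y z : tanCT I) :
  nabla_top x (cstC I k *: y + z) = cstC I k *: nabla_top x y + nabla_top x z.
Proof.
have [X [XT ->]] := rho_topEx x.
have [Y [YT ->]] := rho_topEx y; have [Z [ZT ->]] := rho_topEx z.
have kYT : cst A k *: Y \in tan_top I by apply: (rpredZ (s := tan_top I)).
have kYZT : cst A k *: Y + Z \in tan_top I by apply: (rpredD kYT ZT).
rewrite -(rho_topZ YT kYT) -(rho_topD kYT ZT kYZT) !nabla_topE.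
by rewrite (nabla_linr LC) rho_projP.
Qed.

Lemma nabla_top_leibniz (x : tanCT I) (f : fnC I) (y : tanCT I) :
  nabla_top x (f *: y) = pairCT x (diffCT f) *: y + f *: nabla_top x y.
Proof.
have [a ->] := fnCEx f; have [X [XT ->]] := rho_topEx x.
have [Y [YT ->]] := rho_topEx y.
have aYT : a *: Y \in tan_top I by apply: (rpredZ (s := tan_top I)).
rewrite -(rho_topZ YT aYT) diffCTE pairCTE !nabla_topE (nabla_leibniz LC).
by rewrite rho_projP (rho_proj_top YT) rho_projZ.
Qed.

Lemma nabla_top_torsion (x y : tanCT I) :
  lieCT ordA x y = nabla_top x y - nabla_top y x.
Proof.
have [X [XT ->]] := rho_topEx x; have [Y [YT ->]] := rho_topEx y.
by rewrite lieCTE !nabla_topE -rho_projB -(nabla_torsion LC) -rho_proj_top.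
Qed.

Lemma nabla_top_metric (x y z : tanCT I) :
  pairCT x (diffCT (innerCT g y z)) =
  innerCT g (nabla_top x y) z + innerCT g y (nabla_top x z).
Proof.
have [X [XT ->]] := rho_topEx x; have [Y [YT ->]] := rho_topEx y.
have [Z [ZT ->]] := rho_topEx z.
rewrite !nabla_topE [X in _ = _ + X]innerCT_sym !inner_rho_proj.
rewrite -(rho_proj_top YT) inner_rho_proj diffCTE pairCTE -/(dapp _ _).
by rewrite (nabla_metric LC) rmorphD (inner_sym g Y).
Qed.

Lemma nabla_top_levi_civita :
  @levi_civita K (quotient_space I ordA) (quotient_metric I ordA g) nabla_top.
Proof.
split.
- exact: nabla_top_linl.
- exact: nabla_top_linr.
- exact: nabla_top_leibniz.
- exact: nabla_top_torsion.
- exact: nabla_top_metric.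
Qed.

End Connection.
End Projection.

Theorem theorem2p4p35 (K : comPzRingType) (A : rinehart K) (g : metric A)
    (nabla : tan A -> tan A -> tan A) (I : ideal (fn A)) (p : projection I g)
    (ordA : ordinary A) (musg : musical g) (LC : levi_civita g nabla) :
  exists nablaT : tan (quotient_space I ordA) -> tan (quotient_space I ordA) ->
                  tan (quotient_space I ordA),
    [/\ levi_civita (quotient_metric I ordA g) nablaT,
        forall X Y, nablaT X Y = projC p (nablaC nabla X (tanCT_val Y)) &
        forall nablaT' : tan (quotient_space I ordA) ->
            tan (quotient_space I ordA) -> tan (quotient_space I ordA),
          (forall X Y, nablaT' X Y = projC p (nablaC nabla X (tanCT_val Y))) ->
          nablaT' = nablaT].
Proof.
exists (nabla_top p nabla); split=> //.
  exact: nabla_top_levi_civita musg.2 _ LC.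
by move=> nablaT' eT; apply/funext => X; apply/funext => Y; exact: eT.
Qed.
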